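(* For all integers $h\geq 1$ and $m\geq 1$, $$\Delta(h,m)\leq \Delta(h,m+1)-1.$$ That is, if $(d+1,h,m+1)$ is admissible, then so is $(d,h,m)$.
   Context: A mass in $\mathbb{R}^d$ is a finite measure on the Borel $\sigma$-algebra of $\mathbb{R}^d$ for which every (affine) hyperplane is a set of measure zero. A mass is cut by $h$ hyperplanes into $2^h$ equal pieces if all the $2^h$ orthants given by the hyperplanes (the intersections obtained by choosing one of the two half-spaces of each of the $h$ hyperplanes) have the same measure. A triple $(d,h,m)$ of positive integers is admissible if for any $m$ given masses in $\mathbb{R}^d$ there exist $h$ hyperplanes in $\mathbb{R}^d$ that cut each of these masses into $2^h$ equal pieces. If $(d,h,m)$ is admissible then so is $(d+1,h,m)$. For positive integers $h,m$, $\Delta(h,m)$ denotes the smallest dimension $d$ such that $(d,h,m)$ is admissible. *)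

(* Defs.v *)
From HB Require Import structures.
From mathcomp Require Import all_boot all_order all_algebra.
From mathcomp Require Import all_classical all_reals all_analysis.
Import Order.TTheory GRing.Theory Num.Theory.
Import numFieldNormedType.Exports.

Set Implicit Arguments.
Unset Strict Implicit.
Unset Printing Implicit Defensive.

Local Open Scope classical_set_scope.
Local Open Scope ring_scope.

(* R^d with its Borel sigma-algebra: generated by the open sets of the usual
   (norm) topology on row vectors. *)
Definition borelRd (R : realType) (d : nat) :=
  g_sigma_algebraType (@open 'rV[R]_d).

Definition dotrv (R : realType) (d : nat) (a x : 'rV[R]_d) : R :=
  \sum_(i < d) a 0 i * x 0 i.

(* This is an affine hyperplane only when [a != 0], which every use below
   requires; [b] is arbitrary. *)
Definition hyperplane (R : realType) (d : nat) (a : 'rV[R]_d) (b : R)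
  : set (borelRd R d) := [set x | dotrv a x = b].

(* The two closed half-spaces bounded by [hyperplane a b].  Masses vanish on
   hyperplanes, so open half-spaces would give orthants of the same measure. *)
Definition halfspace (R : realType) (d : nat) (a : 'rV[R]_d) (b : R) (s : bool)
  : set (borelRd R d) :=
  if s then [set x | b <= dotrv a x] else [set x | dotrv a x <= b].

Definition is_mass (R : realType) (d : nat)
    (mu : {finite_measure set (borelRd R d) -> \bar R}) : Prop :=
  forall (a : 'rV[R]_d) (b : R), a != 0 -> mu (hyperplane a b) = 0%E.

Definition orthant (R : realType) (d h : nat)
    (a : 'I_h -> 'rV[R]_d) (b : 'I_h -> R) (s : {ffun 'I_h -> bool})
  : set (borelRd R d) :=
  \bigcap_(j in [set: 'I_h]) halfspace (a j) (b j) (s j).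

Definition cuts_equally (R : realType) (d h : nat)
    (a : 'I_h -> 'rV[R]_d) (b : 'I_h -> R)
    (mu : {finite_measure set (borelRd R d) -> \bar R}) : Prop :=
  forall s t : {ffun 'I_h -> bool}, mu (orthant a b s) = mu (orthant a b t).

Definition admissible (R : realType) (d h m : nat) : Prop :=
  [/\ (0 < d)%N, (0 < h)%N, (0 < m)%N &
    forall mu : 'I_m -> {finite_measure set (borelRd R d) -> \bar R},
      (forall i, is_mass (mu i)) ->
      exists (a : 'I_h -> 'rV[R]_d) (b : 'I_h -> R),
        (forall j, a j != 0) /\ (forall i, cuts_equally a b (mu i))].

(* The smallest [d] with [admissible R d h m]; the value is +oo, the minimum
   of the empty set, if there is none. *)
Definition Delta (R : realType) (h m : nat) : \bar R :=
  match pselect (exists d : nat, `[< admissible R d h m >]) with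
  | left exd => ((ex_minn exd)%:R)%:E
  | right _ => +oo%E
  end.

(* Main.v *)
Require Import Defs.
From HB Require Import structures.
From mathcomp Require Import all_boot all_order all_algebra.
From mathcomp Require Import all_classical all_reals all_analysis.
From mathcomp Require Import measurable_realfun lra.

(** The idea is to lift each mass of [R^d] to a cone with apex the origin of
[R^(d+1)], and to spend the additional mass on forcing the cutting hyperplanes
through that apex.

A point [x] of [R^d] is placed at height one, as [(1, x)], and a mass [mu] is
spread over the rays through these points: [cone_mass mu] is the image of
[lambda x mu] under [(t, x) |-> e^t (1, x)], where [lambda] is Lebesgue measure
on [[-1, 1]].  This is again a mass ([is_mass_cone_mass]).  Whether a ray lies in
a half-space bounded by a hyperplane through the origin depends on [x] alone, so
such a hyperplane cuts the cone exactly as its trace at height one cuts [R^d]: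
an orthant has [cone_mass mu]-measure [2] times the [mu]-measure of its trace
([cone_mass_orthant]).

The additional mass is symmetric about the origin: it is the image of [lambda]
under the odd curve [t |-> (t, t^3, t^5, ...)].  A nonzero linear form,
restricted to the curve, is a nonzero odd polynomial; it takes any given value
finitely often, so every hyperplane is null.  A hyperplane that misses the origin
does not bisect this mass, having more of the curve on the side of the origin
([odd_mass_bisect]).  Cutting a mass into [2^h] equal pieces makes each of the
[h] hyperplanes bisect it ([cuts_equally_bisect]), so all hyperplanes cutting the
family pass through the origin.

The trace of such a hyperplane at height one is a genuine hyperplane, unless it
is the horizontal one; the latter has no cone on one of its sides, which is
impossible if one of the masses of [R^d] is nonzero ([cuts_equally_tail_neq0]).
If all of them vanish, any hyperplanes will do, provided that [d > 0].

For the inequality between the minimal dimensions, the value [1] of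
[Delta R h m.+1] must be excluded.  The cone construction does this as well:
it applies to [d = 0], where the Dirac measure on the one-point space is a mass
because there are no hyperplanes, and would produce one ([can_cut1_absurd]). *)

Import Order.TTheory GRing.Theory Num.Theory.
Import numFieldNormedType.Exports.

Set Implicit Arguments.
Unset Strict Implicit.
Unset Printing Implicit Defensive.

Local Open Scope classical_set_scope.
Local Open Scope ring_scope.

(** * Borel sets of row vectors *)

Lemma dotrvNl (R : realType) d (a x : 'rV[R]_d) : dotrv (- a) x = - dotrv a x.
Proof. by rewrite /dotrv -sumrN; apply: eq_bigr => i _; rewrite mxE mulNr. Qed.

Lemma dot0rv (R : realType) d (x : 'rV[R]_d) : dotrv 0 x = 0.
Proof. by rewrite /dotrv big1// => i _; rewrite mxE mul0r. Qed.

Lemma measurable_coord (R : realType) d (i : 'I_d) :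
  measurable_fun setT (fun x : borelRd R d => (x : 'rV[R]_d) 0 i : measurableTypeR R).
Proof.
apply: (measurability _ (measurable_realfun.RGenOpens.measurableE R)).
move=> _ [_ [a [b ->] <-]]; rewrite setTI; apply: sub_sigma_algebra.
have /continuousP := @coord_continuous R 1 d 0 i.
by apply; exact: interval_open.
Qed.

(** Countably many boxes suffice, which is what makes the Borel sigma-algebra
no larger than the one generated by the coordinates. *)
Lemma open_rV_boxes (R : realType) d (U : set 'rV[R]_d) : open U ->
  let box (q : {ffun 'I_d -> rat * rat}) :=
    [set x : 'rV[R]_d | forall i, ratr (q i).1 < x 0 i < ratr (q i).2] in
  U = \bigcup_(q in [set q | box q `<=` U]) box q.
Proof.
move=> oU box; apply/seteqP; split=> [x Ux|x [q /= qU] /qU//].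
have /nbhs_ballP[e /= e0 xeU] : nbhs x U by exact: open_nbhs_nbhs.
have rat_around i : exists q : rat * rat,
    [/\ x 0 i - e < ratr q.1, ratr q.1 < x 0 i, x 0 i < ratr q.2
      & ratr q.2 < x 0 i + e].
  have [|p] := @rat_in_itvoo R (x 0 i - e) (x 0 i); first by rewrite ltrBlDr ltrDl.
  rewrite in_itv/= => /andP[p1 p2].
  have [|q] := @rat_in_itvoo R (x 0 i) (x 0 i + e); first by rewrite ltrDl.
  rewrite in_itv/= => /andP[q1 q2].
  by exists (p, q).
have [q qP] := choice rat_around.
exists [ffun i => q i] => /=; last first.
  by move=> i; rewrite ffunE; have [_ -> -> _] := qP i.
move=> y yq; apply: xeU; split=> // k i; rewrite ord1.
have [q1 _ _ q2] := qP i; have := yq i; rewrite ffunE => /andP[y1 y2].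
rewrite /ball/= distrC ltr_distl; apply/andP; split.
  exact: lt_trans y1.
exact: lt_trans q2.
Qed.

Lemma measurable_fun_coord (R : realType) d (disp : measure_display)
    (T : measurableType disp) (f : T -> borelRd R d) :
  (forall i, measurable_fun setT (fun t => (f t : 'rV[R]_d) 0 i : measurableTypeR R)) ->
  measurable_fun setT f.
Proof.
move=> mf; apply: (@measurability _ _ T (borelRd R d) setT f (@open 'rV[R]_d) erefl).
move=> _ [U oU <-]; rewrite setTI (open_rV_boxes oU) preimage_bigcup bigcup_mkcond.
apply: countable_bigcupT_measurable => [|q]; first exact: countableP.
case: ifPn => // _.
rewrite [X in measurable X](_ : _ = \bigcap_(i in [set: 'I_d])
    ((fun t => (f t : 'rV[R]_d) 0 i : measurableTypeR R) @^-1`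
     `]ratr (q i).1, ratr (q i).2[%classic)).
  apply: fin_bigcap_measurable => // i _.
  rewrite -[X in measurable X]setTI; apply: mf => //.
apply/seteqP; split=> t /=.
  by move=> H i _ /=; rewrite in_itv/=.
by move=> H i; have := H i I; rewrite /= in_itv.
Qed.

Lemma measurable_dotrv (R : realType) d (a : 'rV[R]_d) :
  measurable_fun setT (fun x : borelRd R d => dotrv a x : measurableTypeR R).
Proof.
rewrite /dotrv; apply: measurable_sum => i.
apply: measurable_funM => //; exact: measurable_coord.
Qed.

Lemma measurable_halfspace (R : realType) d (a : 'rV[R]_d) b s :
  measurable (@halfspace R d a b s).
Proof.
case: s; rewrite /halfspace.
  rewrite [X in measurable X](_ : _ = setT `&`
     (fun x : borelRd R d => dotrv a x : measurableTypeR R) @^-1` `[b, +oo[).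
    by apply: measurable_dotrv => //.
  by apply/seteqP; split=> x /=; rewrite in_itv/= andbT; tauto.
rewrite [X in measurable X](_ : _ = setT `&`
   (fun x : borelRd R d => dotrv a x : measurableTypeR R) @^-1` `]-oo, b]).
  by apply: measurable_dotrv => //.
by apply/seteqP; split=> x /=; rewrite in_itv/=; tauto.
Qed.

Lemma hyperplaneE (R : realType) d (a : 'rV[R]_d) b :
  hyperplane a b = halfspace a b true `&` halfspace a b false.
Proof.
apply/seteqP; split=> x /=; rewrite /hyperplane/=; first by move=> ->.
by move=> [h1 h2]; apply/eqP; rewrite eq_le h1 h2.
Qed.

Lemma measurable_hyperplane (R : realType) d (a : 'rV[R]_d) b :
  measurable (hyperplane a b).
Proof.
by rewrite hyperplaneE; apply: measurableI; exact: measurable_halfspace.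
Qed.

Lemma measurable_orthant (R : realType) d h (a : 'I_h -> 'rV[R]_d) b s :
  measurable (orthant a b s).
Proof. by apply: fin_bigcap_measurable => // i _; exact: measurable_halfspace. Qed.

(** * Equal cuts bisect *)

(** The orthants overlap along the hyperplanes.  Attributing each hyperplane to
its upper side turns them into cells that partition the space, so that the
measures of cells add up exactly. *)
Definition sign_pattern (R : realType) d h (a : 'I_h -> 'rV[R]_d) (b : 'I_h -> R)
  (x : borelRd R d) : {ffun 'I_h -> bool} := [ffun j => b j <= dotrv (a j) x].

Definition cell (R : realType) d h (a : 'I_h -> 'rV[R]_d) b s : set (borelRd R d) :=
  [set x | sign_pattern a b x = s].

Definition half_open (R : realType) d (a : 'rV[R]_d) (b : R) (s : bool) :
  set (borelRd R d) := [set x | (b <= dotrv a x) = s].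

Lemma half_open_sub (R : realType) d (a : 'rV[R]_d) b s :
  half_open a b s `<=` halfspace a b s.
Proof.
case: s => x; rewrite /half_open/halfspace/=; first by move=> ->.
by move/negbT; rewrite -ltNge; exact: ltW.
Qed.

Lemma halfspaceD (R : realType) d (a : 'rV[R]_d) b s :
  halfspace a b s `\` half_open a b s `<=` hyperplane a b.
Proof.
case: s => x; rewrite /half_open/halfspace/hyperplane/= => -[xs].
  by rewrite xs.
by move/eqP; rewrite eqbF_neg negbK => bx; apply/eqP; rewrite eq_le xs bx.
Qed.

Lemma measurable_half_open (R : realType) d (a : 'rV[R]_d) b s :
  measurable (half_open a b s).
Proof.
case: s; first exact: (@measurable_halfspace R d a b true).
rewrite (_ : half_open a b false = ~` half_open a b true).
  by apply: measurableC; exact: (@measurable_halfspace R d a b true).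
by apply/seteqP; split=> x; rewrite /half_open/=; [move=> -> | move/negP/negbTE].
Qed.

Lemma measure_null_diff (R : realType) d (T : measurableType d)
    (mu : {measure set T -> \bar R}) (A B : set T) :
  measurable A -> measurable B ->
  A `<=` B -> mu.-negligible (B `\` A) -> mu B = mu A.
Proof.
move=> mA mB AB BA0; rewrite (measureDI mu mB mA) (setIidr AB).
by rewrite (measure_negligible _ BA0) ?add0e//; exact: measurableD.
Qed.

Section equal_cuts.
Variables (R : realType) (d h : nat) (a : 'I_h -> 'rV[R]_d) (b : 'I_h -> R).
Variable mu : {finite_measure set (borelRd R d) -> \bar R}.
Hypotheses (mass_mu : is_mass mu) (a_neq0 : forall j, a j != 0).

Lemma cellE s : cell a b s = \bigcap_(j in [set: 'I_h]) half_open (a j) (b j) (s j).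
Proof.
apply/seteqP; split=> x; rewrite /cell/half_open/=.
  by move=> <- j _; rewrite ffunE.
by move=> xs; apply/ffunP => j; rewrite ffunE xs.
Qed.

Lemma measurable_cell s : measurable (cell a b s).
Proof.
by rewrite cellE; apply: fin_bigcap_measurable => // j _; exact: measurable_half_open.
Qed.

Lemma negligible_hyperplane j : mu.-negligible (hyperplane (a j) (b j)).
Proof. by apply/negligibleP; [exact: measurable_hyperplane|exact: mass_mu]. Qed.

Lemma measure_half_open j s :
  mu (halfspace (a j) (b j) s) = mu (half_open (a j) (b j) s).
Proof.
apply: measure_null_diff.
- exact: measurable_half_open.
- exact: measurable_halfspace.
- exact: half_open_sub.
- exact: negligibleS (@halfspaceD _ _ _ _ _) (negligible_hyperplane j).
Qed.

Lemma measure_cell s : mu (orthant a b s) = mu (cell a b s).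
Proof.
apply: measure_null_diff.
- exact: measurable_cell.
- exact: measurable_orthant.
- by rewrite cellE => x xs j _; apply: half_open_sub; exact: xs.
- apply: (@negligibleS _ _ _ _ (\big[setU/set0]_(j < h) hyperplane (a j) (b j))).
    move=> x [xs]; rewrite cellE => /existsNP[j /not_implyP[_ xj]].
    rewrite -bigcup_seq; exists j => //=; first exact: mem_index_enum.
    by apply: halfspaceD; split; [exact: xs|exact: xj].
  elim/big_ind : _ => [|A B|j _]; [exact: negligible_set0|exact: negligibleU|].
  exact: negligible_hyperplane.
Qed.

Lemma measure_half_open_cells j t :
  mu (half_open (a j) (b j) t) =
  (\sum_(s \in [set s : {ffun 'I_h -> bool} | s j = t]) mu (cell a b s))%E.
Proof.
rewrite -measure_fin_bigcup.
- congr (mu _); apply/seteqP; split=> x; rewrite /half_open/cell/=.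
    by move=> <-; exists (sign_pattern a b x) => //=; rewrite ffunE.
  by move=> [s/= <- <-]; rewrite ffunE.
- exact: finite_finset.
- by move=> s s' _ _ [x [<- <-]].
- by move=> s _; exact: measurable_cell.
Qed.

Definition flip j (s : {ffun 'I_h -> bool}) : {ffun 'I_h -> bool} :=
  [ffun k => if k == j then ~~ s k else s k].

Lemma flipK j : involutive (flip j).
Proof.
by move=> s; apply/ffunP => k; rewrite !ffunE; case: eqP => // _; rewrite negbK.
Qed.

(** Flipping the [j]-th sign matches the cells on either side of the [j]-th
hyperplane, and all cells have the same measure. *)
Lemma cuts_equally_bisect j : cuts_equally a b mu ->
  mu (halfspace (a j) (b j) true) = mu (halfspace (a j) (b j) false).
Proof.
move=> cut; rewrite !measure_half_open !measure_half_open_cells.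
rewrite [RHS](reindex_fsbig (flip j) [set s : {ffun 'I_h -> bool}| s j = true]).
  by apply: eq_fsbigr => s _; rewrite -!measure_cell.
split=> [s /= sj|s s' _ _ /(congr1 (flip j))|s /= sj].
- by rewrite /= ffunE eqxx sj.
- by rewrite !flipK.
- by exists (flip j s); rewrite ?flipK//= ffunE eqxx sj.
Qed.

End equal_cuts.

(** * Images and products of finite measures *)

Section finite_pushforward.
Context {d1} {d2} {T1 : measurableType d1} {T2 : measurableType d2}
  {R : realType}.
Variables (mu : {finite_measure set T1 -> \bar R}) (f : T1 -> T2).
Hypothesis mf : measurable_fun [set: T1] f.

Let map := pushforward mu f.

Let map0 : map set0 = 0%E. Proof. exact: measure0. Qed.

Let map_ge0 A : (0 <= map A)%E. Proof. exact: measure_ge0. Qed.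

Let map_sigma_additive : semi_sigma_additive map.
Proof. exact: measure_semi_sigma_additive. Qed.

HB.instance Definition _ := isMeasure.Build _ _ _ map
  map0 map_ge0 map_sigma_additive.

Let map_fin : fin_num_fun map.
Proof.
by move=> A mA; apply: fin_num_measure; rewrite -[X in measurable X]setTI; exact: mf.
Qed.

HB.instance Definition _ := Measure_isFinite.Build _ _ _ map map_fin.

Definition finite_pushforward : {finite_measure set T2 -> \bar R} := map.

End finite_pushforward.

Section finite_product.
Context {d1} {d2} {T1 : measurableType d1} {T2 : measurableType d2}
  {R : realType}.
Variables (mu : {finite_measure set T1 -> \bar R})
  (nu : {finite_measure set T2 -> \bar R}).

Let prod := (mu \x nu)%E.

HB.instance Definition _ := Measure.on prod.

Let prod_fin : fin_num_fun prod.
Proof.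
apply: lty_fin_num_fun; rewrite -setXTT [ltLHS]product_measure1E//.
by rewrite lte_mul_pinfty ?measure_ge0// ?fin_num_measure// ltey_eq fin_num_measure.
Qed.

HB.instance Definition _ := Measure_isFinite.Build _ _ _ prod prod_fin.

Definition finite_product : {finite_measure set (T1 * T2)%type -> \bar R} := prod.

End finite_product.

(** * Lebesgue measure on a symmetric interval *)

Section symmetric_interval.
Variable R : realType.

Lemma lebesgue_sym_itv_fin :
  (@lebesgue_measure R `[(-1)%R, 1%R]%classic < +oo)%E.
Proof. by rewrite /= lebesgue_measure_itv/=; case: ifP; rewrite ?ltry// -EFinB ltry. Qed.

Definition sym_meas : {finite_measure set (measurableTypeR R) -> \bar R} :=
  @mfrestr _ (measurableTypeR R) R _ lebesgue_measure
    (measurable_itv `[(-1)%R, 1%R]) lebesgue_sym_itv_fin.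

Lemma sym_measE A : sym_meas A = lebesgue_measure (A `&` `[(-1)%R, 1%R]).
Proof. by []. Qed.

Lemma sym_meas_countable A : measurable A -> countable A -> sym_meas A = 0%E.
Proof.
move=> mA cA; rewrite sym_measE; apply: countable_lebesgue_measure0.
by apply: sub_countable cA; apply: subset_card_le => x [].
Qed.

Lemma sym_measN (A : set R) : measurable A -> sym_meas (-%R @^-1` A) = sym_meas A.
Proof.
move=> mA; rewrite !sym_measE -[RHS]lebesgue_measureN; last exact: measurableI.
congr lebesgue_measure; apply/seteqP; split=> x /= [xA]; rewrite !in_itv/= => /andP[x1 x2];
  split=> //; apply/andP; split; lra.
Qed.

Lemma sym_meas_gt0 (e : R) : 0 < e -> (0 < sym_meas `](- e)%R, e[%classic)%E.
Proof.
move=> e0; pose r := Num.min e 1.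
have r0 : 0 < r by rewrite lt_min e0/=.
have : (0 < @lebesgue_measure R `](- r)%R, r[%classic)%E.
  rewrite lebesgue_measure_itv/= lte_fin ifT; last by lra.
  by rewrite -EFinB lte_fin; lra.
move=> /lt_le_trans; apply; rewrite sym_measE; apply: le_measure; rewrite ?inE//=.
  exact: measurableI.
move=> x/=; rewrite !in_itv/= ltrNl => /andP[]; rewrite /r !lt_min => /andP[? ?] /andP[? ?].
by split; apply/andP; split; lra.
Qed.

(** If [b > 0], then by symmetry [b <= f] is as large as [f <= - b]; the set
[f <= b] contains the latter together with a neighbourhood of [0], on which
[|f| < b], and so is strictly larger. *)
Lemma odd_bisect_le0 (f : R -> R) b :
  continuous f -> (forall t, f (- t) = - f t) ->
  sym_meas [set t | b <= f t] = sym_meas [set t | f t <= b] -> b <= 0.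
Proof.
move=> cf oddf; apply: contraPP => /negP; rewrite -ltNge => b0.
have mf := continuous_measurable_fun cf.
have mle c : measurable [set t | f t <= c].
  have := mf measurableT `]-oo, c]%classic (measurable_itv _).
  by rewrite setTI; congr measurable; apply/seteqP; split=> x /=; rewrite in_itv.
have mge c : measurable [set t | c <= f t].
  have := mf measurableT `[c, +oo[%classic (measurable_itv _).
  by rewrite setTI; congr measurable; apply/seteqP; split=> x /=; rewrite in_itv/= andbT.
rewrite -(sym_measN (mge b)) => eqb.
have f0 : f 0 = 0 by have := oddf 0; rewrite oppr0; lra.
have /nbhs_ballP[e /= e0 fe] : nbhs (0 : R) [set t | `|f t| < b].
  have : f x @[x --> (0 : R)] --> (0 : R) by rewrite -[X in _ --> X]f0; exact: cf.
  by move=> /cvgr_norm_lt; apply; rewrite normr0.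
have reflect : -%R @^-1` [set t | b <= f t] = [set t | f t <= - b].
  by apply/seteqP; split=> t/=; rewrite oddf; lra.
rewrite reflect in eqb.
have fI t : t \in `](- e), e[ -> `|f t| < b.
  rewrite in_itv/= => te; apply: fe.
  by rewrite /ball/= sub0r normrN ltr_norml.
set low := [set t | f t <= - b] in eqb; set high := [set t | f t <= b] in eqb.
have : (sym_meas low + sym_meas `](- e)%R, e[%classic <= sym_meas high)%E.
  rewrite -measureU//; [|exact: mle|].
  - apply: le_measure; rewrite ?inE//=; first by apply: measurableU => //; exact: mle.
      exact: mle.
    move=> t [|/fI]; rewrite /low/high/=; first by lra.
    by rewrite ltr_norml => /andP[_ /ltW].
  - apply/seteqP; split=> t//= [] + /fI; rewrite /low/= ltr_norml => ? /andP[? _]; lra.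
apply/negP; rewrite -ltNge -eqb lteDl ?sym_meas_gt0//.
by apply: fin_num_measure; exact: mle.
Qed.

End symmetric_interval.

(** * A mass on an odd curve *)

Lemma finite_roots (R : idomainType) (p : {poly R}) : p != 0 -> finite_set [set x | root p x].
Proof.
have [n] := ubnP (size p); elim: n p => // n IH p pn p0.
have [[a ra]|nr] := pselect (exists a, root p a); last first.
  rewrite (_ : [set _ | _] = set0)//; apply/seteqP; split=> // x/= rx.
  by apply: nr; exists x.
have /factor_theorem[q pq] := ra.
have q0 : q != 0 by apply: contra_neq p0; rewrite pq => ->; rewrite mul0r.
apply: (@sub_finite_set _ _ ([set x | root q x] `|` [set a])).
  by move=> x /=; rewrite pq rootM root_XsubC => /orP[|/eqP]; [left|right].
rewrite finite_setU; split=> //; apply: IH => //.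
by move: pn; rewrite pq size_Mmonic ?monicXsubC// size_XsubC addn2.
Qed.

Section odd_curve.
Variables (R : realType) (d : nat).

(** Odd exponents make the curve symmetric about the origin; that they are
distinct makes the coordinates linearly independent, so that the curve meets each
hyperplane in finitely many points. *)
Definition odd_curve (t : measurableTypeR R) : borelRd R d :=
  \row_(i < d) (t : R) ^+ i.*2.+1.

Definition odd_poly_of (a : 'rV[R]_d) : {poly R} :=
  \sum_(i < d) a 0 i *: 'X^(i.*2.+1).

Lemma dotrv_odd_curve (a : 'rV[R]_d) (t : R) :
  dotrv a (odd_curve t) = (odd_poly_of a).[t].
Proof.
rewrite /dotrv /odd_poly_of horner_sum; apply: eq_bigr => i _.
by rewrite mxE hornerZ hornerXn.
Qed.

Lemma odd_poly_ofN (a : 'rV[R]_d) (t : R) :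
  (odd_poly_of a).[- t] = - (odd_poly_of a).[t].
Proof.
rewrite /odd_poly_of !horner_sum -sumrN; apply: eq_bigr => i _.
by rewrite !hornerZ !hornerXn exprNn -signr_odd /= odd_double/= expr1 mulN1r mulrN.
Qed.

Lemma odd_poly_of_neqC (a : 'rV[R]_d) (b : R) : a != 0 -> odd_poly_of a - b%:P != 0.
Proof.
apply: contra_neq => ab; apply/rowP => i; rewrite mxE.
have /(congr1 (fun p : {poly R} => p`_(i.*2.+1))) := ab.
rewrite coefB coefC subr0 coef0 /odd_poly_of coef_sum (bigD1 i)//= big1 ?addr0.
  by rewrite coefZ coefXn eqxx mulr1.
move=> k ki; rewrite coefZ coefXn eqSS -!muln2 eqn_pmul2r// eq_sym.
by rewrite (inj_eq val_inj) (negbTE ki) mulr0.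
Qed.

Lemma measurable_odd_curve : measurable_fun setT odd_curve.
Proof.
apply: measurable_fun_coord => i.
under eq_fun do rewrite mxE.
by apply: continuous_measurable_fun; exact: exprn_continuous.
Qed.

Definition odd_mass : {finite_measure set (borelRd R d) -> \bar R} :=
  finite_pushforward (sym_meas R) measurable_odd_curve.

Lemma odd_massE A : odd_mass A = sym_meas R (odd_curve @^-1` A).
Proof. by []. Qed.

Lemma is_mass_odd_mass : is_mass odd_mass.
Proof.
move=> a b a0; rewrite odd_massE; apply: sym_meas_countable.
  rewrite -[X in measurable X]setTI; apply: measurable_odd_curve => //.
  exact: measurable_hyperplane.
apply: finite_set_countable.
apply: sub_finite_set (finite_roots (odd_poly_of_neqC b a0)) => t.
rewrite /hyperplane/= dotrv_odd_curve => tb.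
by rewrite rootE !hornerE tb subrr.
Qed.

Lemma odd_mass_bisect_le0 (a : 'rV[R]_d) (b : R) :
  odd_mass (halfspace a b true) = odd_mass (halfspace a b false) -> b <= 0.
Proof.
rewrite !odd_massE => ab.
apply: (@odd_bisect_le0 R (horner (odd_poly_of a))).
- exact: continuous_horner.
- exact: odd_poly_ofN.
- move: ab; congr (sym_meas _ _ = sym_meas _ _); apply/seteqP; split=> t /=;
  by rewrite /halfspace/= dotrv_odd_curve.
Qed.

Lemma halfspaceN (a : 'rV[R]_d) (b : R) s :
  halfspace (- a) (- b) s = halfspace a b (~~ s).
Proof.
by case: s; apply/seteqP; split=> x; rewrite /halfspace/= dotrvNl lerN2.
Qed.

(** [odd_mass_bisect_le0] applies to both descriptions of the hyperplane, by
[(a, b)] and by [(- a, - b)]. *)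
Lemma odd_mass_bisect (a : 'rV[R]_d) (b : R) :
  odd_mass (halfspace a b true) = odd_mass (halfspace a b false) -> b = 0.
Proof.
move=> ab; apply/eqP; rewrite eq_le (odd_mass_bisect_le0 ab)/= -oppr_le0.
by apply: (@odd_mass_bisect_le0 (- a)); rewrite !halfspaceN.
Qed.

End odd_curve.

(** * The cone over a mass *)

Section cone.
Variables (R : realType) (d : nat).
Implicit Types (a : 'rV[R]_d.+1) (mu : {finite_measure set (borelRd R d) -> \bar R}).

(** Coordinate [0] is the height.  The factor [expR] keeps the heights positive
for all real [t], so that no restriction on [t] is needed. *)
Definition cone_map (p : (measurableTypeR R * borelRd R d)%type) : borelRd R d.+1 :=
  \row_i (expR p.1 * (if unlift ord0 i is Some k then (p.2 : 'rV[R]_d) 0 k else 1)).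

Definition tail a : 'rV[R]_d := \row_k a 0 (lift ord0 k).

Lemma dotrv_cone_map a p :
  dotrv a (cone_map p) = expR p.1 * (a 0 ord0 + dotrv (tail a) p.2).
Proof.
rewrite /dotrv big_ord_recl mxE unlift_none mulr1 mulrDr mulrC; congr (_ + _).
rewrite mulr_sumr; apply: eq_bigr => k _; rewrite !mxE liftK.
by rewrite mulrCA.
Qed.

Lemma tail_eq0 a : tail a = 0 -> a != 0 -> a 0 ord0 != 0.
Proof.
move=> ta; apply: contra_neq => a0; apply/rowP => i; rewrite mxE.
have [k ->|->//] := unliftP ord0 i.
by have /rowP/(_ k) := ta; rewrite !mxE.
Qed.

Lemma measurable_cone_map : measurable_fun setT cone_map.
Proof.
apply: measurable_fun_coord => i.
under eq_fun do rewrite mxE.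
apply: measurable_funM.
  by apply: measurableT_comp => //; exact: measurable_fst.
case: (unlift ord0 i) => [k|//].
by apply: (measurableT_comp (measurable_coord k)); exact: measurable_snd.
Qed.

Definition cone_mass mu : {finite_measure set (borelRd R d.+1) -> \bar R} :=
  finite_pushforward (finite_product (sym_meas R) mu) measurable_cone_map.

Lemma cone_massE mu A : cone_mass mu A = (sym_meas R \x mu)%E (cone_map @^-1` A).
Proof. by []. Qed.

Lemma countable_expR_mul_eq (c b : R) : c != 0 -> countable [set t : R | expR t * c = b].
Proof.
move=> c0; apply: (@sub_countable _ _ _ [set ln (b / c)]); last exact: countable1.
by apply: subset_card_le => t /= <-; rewrite mulfK// expRK.
Qed.

(** A hyperplane meets each slice [{t} x R^d] in a hyperplane of [R^d], unless it
is horizontal, in which case it meets at most one slice. *)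
Lemma is_mass_cone_mass mu : is_mass mu -> is_mass (cone_mass mu).
Proof.
move=> mass_mu a b a0; rewrite cone_massE.
have [ta|ta] := eqVneq (tail a) 0.
  rewrite (_ : _ @^-1` _ = [set t : measurableTypeR R | expR t * a 0 ord0 = b] `*` setT).
    have cA := countable_expR_mul_eq b (tail_eq0 ta a0).
    have mA : measurable [set t : measurableTypeR R | expR t * a 0 ord0 = b].
      by apply: countable_measurable => // t; exact: measurable_set1.
    by rewrite product_measure1E// [X in (X * _)%E](sym_meas_countable mA cA) mul0e.
  by apply/seteqP; split=> -[t x] /=; rewrite /hyperplane/= dotrv_cone_map ta dot0rv addr0;
    [move=> ->|case].
rewrite /product_measure1; apply: integral0_eq => t _ /=.
rewrite (_ : xsection _ t = hyperplane (tail a) (b / expR t - a 0 ord0)).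
  exact: mass_mu.
apply/seteqP; split=> x; rewrite /xsection/hyperplane/= ?inE/= dotrv_cone_map/=.
  by move=> <-; rewrite mulrC mulKf ?gt_eqF ?expR_gt0// addrC addKr.
by move=> ->; rewrite subrKC mulrC divfK ?gt_eqF ?expR_gt0.
Qed.

(** A linear hyperplane has equation [e^t (a_0 + <tail a, x>) = 0] on the cone, and
the positive factor [e^t] does not affect signs: orthants pull back to
products. *)
Lemma cone_mass_orthant mu h (a : 'I_h -> 'rV[R]_d.+1) s :
  cone_mass mu (orthant a (fun=> 0) s) =
  (sym_meas R setT * mu (orthant (fun j => tail (a j)) (fun j => - a j 0 ord0)%R s))%E.
Proof.
rewrite cone_massE -product_measure1E//; last exact: measurable_orthant.
congr (_ _); apply/seteqP.
have halfE j t x : halfspace (a j) 0 (s j) (cone_map (t, x)) <->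
    halfspace (tail (a j)) (- a j 0 ord0) (s j) x.
  rewrite /halfspace; case: (s j); rewrite /= dotrv_cone_map/=.
    by rewrite pmulr_rge0 ?expR_gt0// -lerBlDl sub0r.
  by rewrite pmulr_rle0 ?expR_gt0// -lerBrDl sub0r.
split=> -[t x] /=; first by move=> xs; split=> // j _; apply/halfE; exact: xs.
by move=> [_ xs] j _; apply/halfE; exact: xs.
Qed.

End cone.

(** * From [R^(d+1)] to [R^d] *)

Lemma orthant_total (R : realType) d h (a : 'I_h -> 'rV[R]_d) b :
  forall x, orthant a b (sign_pattern a b x) x.
Proof.
move=> x j _; rewrite ffunE; have := leP (b j) (dotrv (a j) x).
by rewrite /halfspace; case: ltrP => //= /ltW.
Qed.

Definition equally_cuttable (R : realType) d h m
    (mu : 'I_m -> {finite_measure set (borelRd R d) -> \bar R}) :=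
  exists (a : 'I_h -> 'rV[R]_d) (b : 'I_h -> R),
    (forall j, a j != 0) /\ (forall i, cuts_equally a b (mu i)).

(** This is [admissible] without the positivity conditions; [d = 0] is wanted
in [can_cut1_absurd]. *)
Definition can_cut (R : realType) d h m :=
  forall mu : 'I_m -> {finite_measure set (borelRd R d) -> \bar R},
    (forall i, is_mass (mu i)) -> equally_cuttable h mu.

(** If [tail (a j) = 0], then the [j]-th condition is independent of [x] and fails
for one choice of sign; so some orthant is empty, all orthants are null, and they
cover the space. *)
Lemma cuts_equally_tail_neq0 (R : realType) d h (a : 'I_h -> 'rV[R]_d.+1)
    (mu : {finite_measure set (borelRd R d) -> \bar R}) :
  (forall j, a j != 0) -> mu setT != 0%E ->
  cuts_equally (fun j => tail (a j)) (fun j => - a j 0 ord0) mu ->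
  forall j, tail (a j) != 0.
Proof.
move=> a0 mu0 cut j; apply: contra_neq mu0 => ta.
pose O := orthant (fun j => tail (a j)) (fun j => - a j 0 ord0).
have [s Os] : exists s, O s = set0.
  (* [dotrv (tail (a j)) x] is [0]; pick the side of [- a j 0 ord0] without [0] *)
  exists [ffun=> 0 < - a j 0 ord0]; apply/seteqP; split=> // x /(_ j I).
  have c0 := tail_eq0 ta (a0 j).
  rewrite /halfspace ffunE ta; case: ltP => /=; rewrite dot0rv; first by move=> /lt_geF ->.
  by rewrite le_eqVlt oppr_eq0 (negbTE c0)/= => /lt_geF ->.
have O0 t : mu (O t) = 0%E by rewrite -(measure0 mu) -Os; exact: cut.
apply: measure_negligible => //; apply: (@negligibleS _ _ _ _ (\big[setU/set0]_t O t)).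
  move=> x _; rewrite -bigcup_seq; eexists; last exact: orthant_total.
  exact: mem_index_enum.
elim/big_ind : _ => [|A B|t _]; [exact: negligible_set0|exact: negligibleU|].
by apply/negligibleP; [exact: measurable_orthant|exact: O0].
Qed.

(** One nonzero mass is enough to exclude horizontal hyperplanes, since the
hyperplanes are common to all masses. *)
Lemma can_cut_cone (R : realType) d h m
    (mu : 'I_m -> {finite_measure set (borelRd R d) -> \bar R}) :
  can_cut R d.+1 h m.+1 -> (forall i, is_mass (mu i)) ->
  (exists i, mu i setT != 0%E) -> equally_cuttable h mu.
Proof.
move=> cut mass_mu [i0 mui0].
pose nu (i : 'I_m.+1) := if unlift ord0 i is Some k then cone_mass (mu k) else odd_mass R d.+1.
have [i|a [b [a0 cutab]]] := cut nu.
  rewrite /nu; case: (unlift ord0 i) => [k|]; last exact: is_mass_odd_mass.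
  exact: is_mass_cone_mass.
have b0 : b = fun=> 0.
  apply/funext => j; apply: (@odd_mass_bisect R d.+1 (a j)).
  have cut0 : cuts_equally a b (odd_mass R d.+1).
    by have := cutab ord0; rewrite /nu unlift_none.
  exact: (cuts_equally_bisect (@is_mass_odd_mass R d.+1) a0 j cut0).
have cut_mu i : cuts_equally (fun j => tail (a j)) (fun j => - a j 0 ord0) (mu i).
  move=> s t; have := cutab (lift ord0 i) s t.
  rewrite /nu liftK b0 !cone_mass_orthant.
  have pos : (0 < sym_meas R setT)%E.
    apply: lt_le_trans (sym_meas_gt0 ltr01) _.
    by apply: le_measure; rewrite ?inE.
  exact: (inc_inj (lee_pmul2l (fin_num_measure (sym_meas R) _ measurableT) pos)).
exists (fun j => tail (a j)), (fun j => - a j 0 ord0); split=> // j.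
exact: cuts_equally_tail_neq0 a0 mui0 (cut_mu i0) j.
Qed.

Lemma can_cut_descends (R : realType) d h m : (0 < d)%N ->
  can_cut R d.+1 h m.+1 -> can_cut R d h m.
Proof.
move=> d0 cut mu mass_mu.
have [mu0|] := pselect (exists i, mu i setT != 0%E); first exact: can_cut_cone.
move=> /forallNP mu0.
exists (fun=> const_mx 1), (fun=> 0); split=> [_|i s t].
  apply/eqP => /rowP/(_ (Ordinal d0)); rewrite !mxE => /eqP.
  by rewrite oner_eq0.
have O0 u : mu i (orthant (fun=> const_mx 1) (fun=> 0) u) = 0%E.
  apply: (@subset_measure0 _ _ _ (mu i) _ setT) => //; first exact: measurable_orthant.
  by apply/eqP; apply: contrapT => /negP; exact: mu0.
by rewrite !O0.
Qed.

(** Here the masses live on [R^0], where every vector [a j] is zero. *)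
Lemma can_cut1_absurd (R : realType) h m : (0 < h)%N -> (0 < m)%N ->
  ~ can_cut R 1 h m.+1.
Proof.
move=> h0 m0 cut.
pose mu (i : 'I_m) : {finite_measure set (borelRd R 0) -> \bar R} :=
  @dirac _ (borelRd R 0) point R.
have [||a [_ [a0 _]]] := @can_cut_cone R 0 h m mu cut.
- by move=> i a b; rewrite thinmx0 eqxx.
- by exists (Ordinal m0); rewrite [X in X != _](diracT _ point) onee_neq0.
- by have := a0 (Ordinal h0); rewrite thinmx0 eqxx.
Qed.

Theorem lemma2p2 (R : realType) (h m : nat) (hh : (1 <= h)%N) (hm : (1 <= m)%N) :
  (Delta R h m <= Delta R h m.+1 - 1)%E /\
  (forall d : nat, (1 <= d)%N ->
     admissible R d.+1 h m.+1 -> admissible R d h m).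
Proof.
have descends d : (1 <= d)%N -> admissible R d.+1 h m.+1 -> admissible R d h m.
  by move=> d0 [_ _ _ cut]; split=> //; exact: can_cut_descends.
split=> //; rewrite [X in (_ <= X - _)%E]/Delta.
case: pselect => [ex1|_]; last by rewrite addye// leey.
case: ex_minnP => -[|[|d]] /asboolP adm _.
- by case: adm.
- by case: adm => _ _ _ /can_cut1_absurd[].
have {}adm := descends d.+1 isT adm.
rewrite /Delta; case: pselect => [ex2|]; last by case; exists d.+1; apply/asboolP.
case: ex_minnP => d' _ /(_ d.+1) d'd.
by rewrite -EFinB lee_fin lerBrDr natr1 ler_nat ltnS d'd//; apply/asboolP.
Qed.
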